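(* Let $T=\mathbb{R}^n$ and let $\alpha\in\Lambda^pT$ be an $E$-stable form on $T$, where $E\subset T$ is a subspace of codimension one. Then every flag $E_0\subsetneq\dots\subsetneq E_n$ in $T$ (with $\dim E_i=i$) such that $E_{n-1}=E$ is $\mathcal{I}^\alpha$-ordinary.
   Context: $T$ is identified with its dual by the standard metric, with basis $e^1,\dots,e^n$. For $\zeta\in\mathfrak{gl}(T)$ let $D_\zeta$ be the degree-zero derivation of $\Lambda^*T$ extending $\zeta\colon T\to T$ and $\mathfrak{gl}(T)\cdot\alpha=\{D_\zeta\alpha\mid\zeta\in\mathfrak{gl}(T)\}$. For a subspace $E\subset T$ with restriction map $\pi_E\colon\Lambda^pT\to\Lambda^pE$, $\alpha\in\Lambda^pT$ is $E$-stable if $\pi_E(\mathfrak{gl}(T)\cdot\alpha)=\Lambda^pE$. Let $A$ be the algebra generated by $\alpha$. For $W\subset T$, $c(W)$ is the dimension of the subspace of $\mathfrak{gl}(T)^*$ spanned by the functionals $\zeta\mapsto(D_\zeta\beta)(w_1,\dots,w_q)$, with $q\ge1$, $\beta\in A\cap\Lambda^qT$, $w_1,\dots,w_q\in W$. For $\eta=(\eta_{ijk})\in\mathfrak{gl}(T)\otimes T$, let $d_\eta$ be the degree-one derivation of $\Lambda^*T$ with $d_\eta(e^i)=-\sum_{j,k}\eta_{ijk}\,e^k\wedge e^j$, and let $Z_{A,0}=\{\eta: d_\eta|_A=0\}$. A flag $W_0\subsetneq\dots\subsetneq W_n=T$ is $\mathcal{I}^\alpha$-ordinary (that is, $\mathcal{I}_A$-ordinary)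 if \[c(W_0)+\dots+c(W_{n-1})=\dim\frac{\mathfrak{gl}(T)\otimes T}{Z_{A,0}}.\] *)

(* Defs.v *)
From HB Require Import structures.
From mathcomp Require Import all_boot all_order all_algebra all_field.
Set Implicit Arguments.
Unset Strict Implicit.
Unset Printing Implicit Defensive.
Import GRing.Theory.
Local Open Scope ring_scope.

(* The exterior algebra of T = K^n.  A form beta is stored through its
   coordinates: beta I is the coefficient of e^I = e^{i_1} /\ ... /\ e^{i_p},
   I = {i_1 < ... < i_p}. *)
Definition ext (K : fieldType) (n : nat) := {ffun {set 'I_n} -> K^o}.

HB.instance Definition _ (K : fieldType) (n : nat) :=
  Vector.copy (ext K n) {ffun {set 'I_n} -> K^o}.

(* e^I /\ e^J = (-1) ^+ ninv I J *: e^(I u J) for disjoint I and J. *)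
Definition ninv (n : nat) (I J : {set 'I_n}) : nat :=
  \sum_(i in I) \sum_(j in J) (j < i)%N.

Section ExtAlgebra.
Variables (K : fieldType) (n : nat).
Implicit Types (I J L : {set 'I_n}) (b c d : ext K n).

Lemma ninvUl I J L : [disjoint I & J] ->
  ninv (I :|: J) L = (ninv I L + ninv J L)%N.
Proof.
move=> dIJ; rewrite /ninv -bigU //; apply: eq_bigl => x.
by rewrite !inE.
Qed.

Lemma ninvUr I J L : [disjoint I & J] ->
  ninv L (I :|: J) = (ninv L I + ninv L J)%N.
Proof.
move=> dIJ; rewrite /ninv -big_split; apply: eq_bigr => i _ /=.
by rewrite -bigU //; apply: eq_bigl => x; rewrite !inE.
Qed.

Lemma ninv0l I : ninv set0 I = 0%N.
Proof. by rewrite /ninv big_set0. Qed.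

Lemma ninv0r I : ninv I set0 = 0%N.
Proof. by rewrite /ninv big1 // => i _; rewrite big_set0. Qed.

Lemma ninvC I J : [disjoint I & J] -> (ninv I J + ninv J I)%N = (#|I| * #|J|)%N.
Proof.
move=> dIJ; rewrite /ninv [X in (_ + X)%N]exchange_big /= -big_split /=.
rewrite -sum_nat_const; apply: eq_bigr => i iI.
rewrite -big_split /= -sum1_card; apply: eq_bigr => j jJ.
case: ltngtP => // eij; move/pred0P/(_ i): dIJ => /=.
by rewrite -(val_inj eij) jJ (val_inj eij) iI.
Qed.

Definition ext_e I : ext K n := [ffun J => (J == I)%:R].

(* The wedge product; it is the ring multiplication of [ext K n]. *)
Definition ext_mul b c : ext K n :=
  [ffun L : {set 'I_n} => \sum_(I : {set 'I_n} | I \subset L)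
     (-1) ^+ ninv I (L :\: I) * (b I * c (L :\: I))].

Fact ext_mulA : associative ext_mul.
Proof.
move=> b c d; apply/ffunP => L; rewrite !ffunE.
pose F (I M : {set 'I_n}) := (-1) ^+ (ninv I (L :\: I) + ninv (M :\: I) (L :\: M))%N *
     (b I * (c (M :\: I) * d (L :\: M))) : K.
transitivity (\sum_(I : {set 'I_n} | I \subset L) \sum_(M : {set 'I_n} | (M \subset L) && (I \subset M)) F I M).
  apply: eq_bigr => I IL; rewrite ffunE big_distrr big_distrr /=.
  rewrite (reindex_onto (fun M : {set 'I_n} => M :\: I) (fun J => I :|: J)) /=; last first.
    move=> J JLI; rewrite setDUl setDv set0U; apply/setDidPl.
    by move: JLI; rewrite subsetD => /andP[].
  apply: eq_big => M.
    apply/andP/andP => [[/subsetP s /eqP <-]|[ML IM]].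
      rewrite subUset IL subsetUl; split=> //=; apply/subsetP => x xM.
      by have := s x xM; rewrite inE => /andP[].
    by rewrite setSD //; split=> //; apply/eqP; rewrite setDE setUIr setUCr setIT; apply/setUidPr.
  case/andP=> _ /eqP eM; rewrite /F exprD.
  have -> : L :\: I :\: (M :\: I) = L :\: M.
    by rewrite setDDl -[in RHS]eM; congr (_ :\: _).
  by rewrite !mulrA -!(mulrAC _ (b I)).
rewrite (exchange_big_dep (fun M : {set 'I_n} => M \subset L)) /=; last by move=> I M _ /andP[].
apply: eq_bigr => M ML; rewrite ffunE big_distrl big_distrr /=.
apply: eq_big => I.
  by rewrite ML andTb; apply: andb_idl => IM; apply: subset_trans ML.
case/and3P=> IL _ IM; rewrite /F.
have dMI : [disjoint M :\: I & L :\: M].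
  by rewrite -setI_eq0; apply/eqP/setP => x; rewrite !inE; case: (x \in M); rewrite ?andbF.
have dI : [disjoint I & M :\: I].
  by rewrite -setI_eq0; apply/eqP/setP => x; rewrite !inE; case: (x \in I); rewrite ?andbF.
have e1 : L :\: I = (M :\: I) :|: (L :\: M).
  apply/setP => x; rewrite !inE.
  move: (introT implyP (subsetP IM x)) (introT implyP (subsetP ML x)).
  by case: (x \in I); case: (x \in M); case: (x \in L).
have e2 : M = I :|: (M :\: I).
  apply/setP => x; rewrite !inE; move: (introT implyP (subsetP IM x)).
  by case: (x \in I); case: (x \in M).
rewrite e1 ninvUr // [in ninv M _]e2 ninvUl //.
by rewrite -e2 -addnA exprD -mulrA mulrCA; congr (_ * _); rewrite !mulrA.
Qed.

Fact ext_mul1l : left_id (ext_e set0) ext_mul.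
Proof.
move=> b; apply/ffunP => L; rewrite ffunE (bigD1 set0) ?sub0set //= big1.
  by rewrite addr0 ninv0l setD0 ffunE eqxx !mul1r.
by move=> I /andP[_ nI0]; rewrite ffunE (negPf nI0) mul0r mulr0.
Qed.

Fact ext_mul1r : right_id (ext_e set0) ext_mul.
Proof.
move=> b; apply/ffunP => L; rewrite ffunE (bigD1 L) //= big1.
  by rewrite addr0 setDv ninv0r ffunE eqxx mul1r mulr1.
move=> I /andP[IL nIL]; rewrite ffunE setD_eq0.
have [LI|_] := boolP (L \subset I); first by rewrite eqEsubset IL LI in nIL.
by rewrite !mulr0.
Qed.

Fact ext_mulDl : left_distributive ext_mul +%R.
Proof.
move=> b c d; apply/ffunP => L; rewrite !ffunE -big_split; apply: eq_bigr => I _.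
by rewrite ffunE mulrDl mulrDr.
Qed.

Fact ext_mulDr : right_distributive ext_mul +%R.
Proof.
move=> b c d; apply/ffunP => L; rewrite !ffunE -big_split; apply: eq_bigr => I _.
by rewrite ffunE !mulrDr.
Qed.

Fact ext_1neq0 : ext_e set0 != 0.
Proof. by apply/eqP => /ffunP/(_ set0)/eqP; rewrite !ffunE eqxx oner_eq0. Qed.

HB.instance Definition _ := GRing.Zmodule_isNzRing.Build (ext K n)
  ext_mulA ext_mul1l ext_mul1r ext_mulDl ext_mulDr ext_1neq0.

Fact ext_scaleAl (k : K) b c : k *: (b * c) = (k *: b) * c.
Proof.
apply/ffunP => L; rewrite !ffunE scaler_sumr; apply: eq_bigr => I _ /=.
by rewrite ffunE scalerAr scalerAl.
Qed.

HB.instance Definition _ := GRing.Lmodule_isLalgebra.Build K (ext K n) ext_scaleAl.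

Fact ext_scaleAr (k : K) b c : k *: (b * c) = b * (k *: c).
Proof.
apply/ffunP => L; rewrite !ffunE scaler_sumr; apply: eq_bigr => I _ /=.
by rewrite ffunE !scalerAr.
Qed.

HB.instance Definition _ := GRing.Lalgebra_isAlgebra.Build K (ext K n) ext_scaleAr.
HB.instance Definition _ := Algebra_isFalgebra.Build K (ext K n).

Lemma extME b c L : (b * c) L = \sum_(I : {set 'I_n} | I \subset L)
   (-1) ^+ ninv I (L :\: I) * (b I * c (L :\: I)).
Proof. by rewrite ffunE. Qed.

End ExtAlgebra.

Section Forms.
Variables (K : fieldType) (n : nat).
Implicit Types (I J L : {set 'I_n}) (b c d : ext K n) (i : 'I_n).

Definition homog (p : nat) b : bool := [forall I, (b I != 0) ==> (#|I| == p)].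

Definition gen i : ext K n := ext_e K [set i].

(* The inclusion of T in the exterior algebra as its degree-one part. *)
Definition covec (v : 'rV[K]_n) : ext K n := \sum_i v 0 i *: gen i.

(* Interior product with the i-th vector of the standard basis. *)
Definition contre i b : ext K n :=
  [ffun L : {set 'I_n} =>
     if i \in L then 0 else (-1) ^+ ninv [set i] L * b (i |: L)].

Definition contr (v : 'rV[K]_n) b : ext K n := \sum_i v 0 i *: contre i b.

(* b(w_1, ..., w_q) is the scalar obtained by contracting b with w_1, then w_2,
   and so on; by [feval_det] below, (v_1 /\ ... /\ v_q)(w_1, ..., w_q) is the
   determinant of the matrix of the scalar products <v_a, w_b>. *)
Definition feval b (q : nat) (w : 'I_q -> 'rV[K]_n) : K :=
  (foldl (fun c v => contr v c) b (codom w)) set0.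

(* The derivation of degree d mapping e^i to phi i, where phi i is homogeneous
   of degree d + 1, written through interior products.  That it is a derivation
   with these values on generators, and the only one, is proved in
   [ext_der_derivation], [ext_der_e] and [graded_derivation_uniq]. *)
Definition ext_der (phi : 'I_n -> ext K n) b : ext K n :=
  \sum_i phi i * contre i b.

Definition graded_derivation (d : nat) (D : ext K n -> ext K n) : Prop :=
  [/\ linear D,
      forall p b, homog p b -> homog (p + d) (D b)
    & forall p b c, homog p b ->
        D (b * c) = D b * c + (-1) ^+ (d * p) *: (b * D c)].

Definition gsgn b : ext K n := [ffun L : {set 'I_n} => (-1) ^+ #|L| * b L].

Lemma homogP p b : reflect (forall I, #|I| != p -> b I = 0) (homog p b).
Proof.
apply: (iffP forallP) => [h I | h I]; last first.
  by apply/implyP; apply: contraNT => /h ->.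
by have := h I; case: eqVneq => //= _ ->.
Qed.

Lemma contreM i b c : contre i (b * c) = contre i b * c + gsgn b * contre i c.
Proof.
apply/ffunP => L; rewrite [RHS]ffunE !extME [LHS]ffunE.
have sgnE (m k : nat) : odd m = odd k -> (-1) ^+ m = (-1) ^+ k :> K.
  by move=> e; rewrite -signr_odd e signr_odd.
have sg3 (m1 m2 m3 : nat) (x y : K) : (-1) ^+ m1 * (((-1) ^+ m2 * x) * ((-1) ^+ m3 * y))
    = (-1) ^+ (m1 + m2 + m3) * (x * y).
  by rewrite !exprD -!mulrA; congr (_ * (_ * _)); rewrite mulrCA.
have sgA (m1 m2 m3 m4 m5 : nat) (x y : K) : odd (m1 + m2 + m3).+1 = odd (m4 + m5) ->
    (-1) ^+ m1 * (((-1) ^+ m2 * x) * ((-1) ^+ m3 * y))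
    = - ((-1) ^+ m4 * (((-1) ^+ m5 * x) * y)).
  move=> /sgnE e; rewrite -[y in RHS]mul1r -[1 in RHS](expr0 (-1)) !sg3 addn0 -e.
  by rewrite exprS mulN1r mulNr opprK.
have sgB (m1 m2 m4 m5 : nat) (x y : K) : odd (m1 + m2) = odd (m4 + m5) ->
    (-1) ^+ m1 * ((-1) ^+ m2 * (x * y)) = (-1) ^+ m4 * (((-1) ^+ m5 * x) * y).
  move=> /sgnE e; rewrite -[y in RHS]mul1r -[1 in RHS](expr0 (-1)) !sg3 addn0 -e.
  by rewrite exprD !mulrA.
have sgC (m1 m2 m3 m4 m5 : nat) (x y : K) : odd (m1 + m2) = odd (m3 + m4 + m5) ->
    (-1) ^+ m1 * ((-1) ^+ m2 * (x * y)) = (-1) ^+ m3 * (((-1) ^+ m4 * x) * ((-1) ^+ m5 * y)).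
  by move=> /sgnE e; rewrite !sg3 -e exprD !mulrA.
have dI I : i \notin I -> [disjoint [set i] & I] by rewrite disjoints1.
have reidx (Q : pred {set 'I_n}) (F : {set 'I_n} -> K) :
    \sum_(I | Q I && (i \in I)) F I
      = \sum_(I | Q (i |: I) && (i \notin I)) F (i |: I).
  rewrite (reindex_onto (fun I => i |: I) (fun I => I :\ i)) /=; last first.
    by move=> I /andP[_ iI]; rewrite setD1K.
  apply: eq_bigl => I; rewrite setU11 andbT; congr (_ && _).
  apply/eqP/idP => [<-|iI]; first by rewrite !inE eqxx.
  by rewrite setU1K.
have [iL|iL] := boolP (i \in L).
  rewrite (bigID (fun I => i \in I)) /= big1 ?add0r; last first.
    by move=> I /andP[_ iI]; rewrite ffunE iI mul0r mulr0.
  rewrite [X in _ = _ + X](bigID (fun I => i \in I)) /= [X in _ = _ + (_ + X)]big1 ?addr0; last first.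
    by move=> I /andP[_ iI]; rewrite [contre _ _ _]ffunE inE iL iI !mulr0.
  rewrite (reidx (fun I => I \subset L)).
  have -> : \sum_(I : {set 'I_n} | (i |: I \subset L) && (i \notin I)) (-1) ^+ ninv (i |: I) (L :\: (i |: I)) * (gsgn b (i |: I) * contre i c (L :\: (i |: I)))
     = \sum_(I : {set 'I_n} | (I \subset L) && (i \notin I)) - ((-1) ^+ ninv I (L :\: I) * (contre i b I * c (L :\: I))).
    apply: eq_big => [I|I /andP[iIL iI]]; first by rewrite subUset sub1set iL.
    have IL : I \subset L by apply: subset_trans iIL; rewrite subsetUr.
    pose J := L :\: (i |: I).
    have iJ : i \notin J by rewrite !inE eqxx.
    have eJ : L :\: I = i |: J.
      apply/setP => x; rewrite !inE.
      by have [->|//] := eqVneq x i; rewrite iI iL.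
    have dIJ : [disjoint I & J].
      rewrite disjoint_sym -setI_eq0; apply/eqP/setP=> x; rewrite !inE.
      by case: (x \in I); rewrite ?orbT ?andbF.
    rewrite eJ -/J !ffunE (negPf iI) (negPf iJ) cardsU1 iI.
    rewrite ninvUl ?dI // ninvUr ?dI //.
    apply: sgA; have := ninvC (dI _ iI); rewrite cards1 mul1n => <-.
    rewrite /= !oddD.
    by case: (odd (ninv [set i] J)); case: (odd (ninv I J)); case: (odd (ninv I [set i])); case: (odd (ninv [set i] I)).
  by rewrite sumrN subrr.
rewrite extME (bigID (fun I => i \in I)) /= (reidx (fun I => I \subset i |: L)) mulrDr.
have subE' I : (I \subset i |: L) && (i \notin I) = (I \subset L).
  by rewrite -subsetD1 setU1K.
have subE I : (i |: I \subset i |: L) && (i \notin I) = (I \subset L).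
  by rewrite -subE' subUset sub1set setU11.
rewrite (eq_bigl _ _ subE) (eq_bigl _ _ subE') !big_distrr /=.
congr (_ + _); apply: eq_bigr => I IL.
  have iI : i \notin I by apply: contra iL; apply: (subsetP IL).
  pose J := L :\: I.
  have iJ : i \notin J by rewrite !inE (negPf iL) andbF.
  have -> : (i |: L) :\: (i |: I) = J.
    apply/setP => x; rewrite !inE; have [->|//] := eqVneq x i.
    by rewrite (negPf iL) andbF.
  rewrite -/J ffunE (negPf iI).
  have -> : ninv [set i] L = (ninv [set i] I + ninv [set i] J)%N.
    rewrite -ninvUr; first by rewrite /J -[in LHS](setID L I) (setIidPr IL).
    by rewrite -setI_eq0 setIDA setD_eq0 subsetIl.
  rewrite ninvUl ?dI //; apply: sgB.
  rewrite !oddD.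
  by case: (odd (ninv [set i] J)); case: (odd (ninv I J)); case: (odd (ninv [set i] I)).
have iI : i \notin I by apply: contra iL; apply: (subsetP IL).
pose J := L :\: I.
have iJ : i \notin J by rewrite !inE (negPf iL) andbF.
have -> : (i |: L) :\: I = i |: J.
  apply/setP => x; rewrite !inE; have [->|//] := eqVneq x i.
  by rewrite iI.
have dIJ : [disjoint I & J].
  by rewrite -setI_eq0 setIDA setD_eq0 subsetIl.
rewrite -/J !ffunE (negPf iJ).
have -> : ninv [set i] L = (ninv [set i] I + ninv [set i] J)%N.
  by rewrite -ninvUr // /J -[in LHS](setID L I) (setIidPr IL).
rewrite ninvUr ?dI //.
apply: sgC; have := ninvC (dI _ iI); rewrite cards1 mul1n => <-.
rewrite !oddD.
by case: (odd (ninv [set i] J)); case: (odd (ninv I J)); case: (odd (ninv I [set i])); case: (odd (ninv [set i] I)).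
Qed.

Lemma contreP i : linear (contre i).
Proof.
move=> k b c; apply/ffunP => L; rewrite !ffunE.
by case: ifP => _; rewrite ?scaler0 ?addr0 // mulrDr scalerAr.
Qed.
HB.instance Definition _ i :=
  GRing.isLinear.Build K (ext K n) (ext K n) _ (contre i) (contreP i).

Lemma contrP v : linear (contr v).
Proof.
move=> k b c; rewrite /contr scaler_sumr -big_split; apply: eq_bigr => i _ /=.
by rewrite linearP scalerDr !scalerA mulrC.
Qed.
HB.instance Definition _ v :=
  GRing.isLinear.Build K (ext K n) (ext K n) _ (contr v) (contrP v).

Lemma ext_derP phi : linear (ext_der phi).
Proof.
move=> k b c; rewrite /ext_der scaler_sumr -big_split; apply: eq_bigr => i _ /=.
by rewrite linearP mulrDr scalerAr.
Qed.

Lemma gsgnE p b : homog p b -> gsgn b = (-1) ^+ p *: b.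
Proof.
move=> /homogP hb; apply/ffunP => L; rewrite !ffunE.
by have [->|/hb ->] := eqVneq #|L| p; rewrite ?mulr0 ?scaler0.
Qed.

Lemma homogM p q b c : homog p b -> homog q c -> homog (p + q) (b * c).
Proof.
move=> /homogP hb /homogP hc; apply/homogP => L hL.
rewrite extME big1 // => I IL.
have [eI|/hb ->] := eqVneq #|I| p; last by rewrite mul0r mulr0.
rewrite (hc (L :\: I)) ?mulr0 //; apply: contra hL => /eqP <-; apply/eqP.
by rewrite -(cardsID I L) (setIidPr IL) eI.
Qed.

Lemma homogC p q b c : homog p b -> homog q c ->
  b * c = (-1) ^+ (p * q) *: (c * b).
Proof.
move=> /homogP hb /homogP hc; apply/ffunP => L; rewrite [RHS]ffunE !extME scaler_sumr.
rewrite (reindex_onto (fun I => L :\: I) (fun I => L :\: I)) /=; last first.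
  by move=> I IL; rewrite setDDr setDv set0U; apply/setIidPr.
apply: eq_big => I.
  rewrite subsetDl setDDr setDv set0U /=; apply/eqP/idP => [<-|/setIidPr //].
  exact: subsetIl.
rewrite setDDr setDv set0U => /andP[_ /eqP eI]; rewrite eI.
have [eI2|/hc ->] := eqVneq #|I| q; last by rewrite !(mul0r, mulr0) scaler0.
have [eD|/hb ->] := eqVneq #|L :\: I| p; last by rewrite !(mul0r, mulr0) scaler0.
have dI : [disjoint I & L :\: I] by rewrite -setI_eq0 setIDA setD_eq0 subsetIl.
rewrite -[_ *: _]/(_ * _) [c _ * _]mulrC !mulrA -exprD.
congr (_ * _ * _ : K); rewrite -signr_odd -[RHS]signr_odd; congr (_ ^+ _).
rewrite oddD -eD -eI2 mulnC -(ninvC dI) oddD.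
by case: (odd _); case: (odd _).
Qed.

Lemma contre_e i j : contre i (gen j) = (i == j)%:R.
Proof.
apply/ffunP => L; rewrite ffunE ffunE.
have -> : ((i == j)%:R : ext K n) L = ((i == j) && (L == set0))%:R.
  by case: (i == j); rewrite ffunE.
case: (boolP (i \in L)) => iL.
  have [eL|] := eqVneq L set0; last by rewrite andbF.
  by rewrite eL inE in iL.
have -> : (i |: L == [set j]) = (i == j) && (L == set0).
  apply/eqP/andP => [e|[/eqP -> /eqP ->]]; last by rewrite setU0.
  have := setU11 i L; rewrite e inE => /eqP eij; split; first exact/eqP.
  by rewrite -(setU1K iL) e eij setDv.
by case: andP => [[_ /eqP ->]|_]; rewrite ?mulr0 // ninv0r mul1r.
Qed.

Lemma homog_e I : homog #|I| (ext_e K I).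
Proof.
by apply/homogP => J; rewrite ffunE; have [->|//] := eqVneq J I; rewrite eqxx.
Qed.

Lemma homog_gen i : homog 1 (gen i).
Proof. by rewrite -(cards1 i) homog_e. Qed.

Lemma homog_sum (T : Type) (r : seq T) (P : pred T) (F : T -> ext K n) p :
  (forall t, P t -> homog p (F t)) -> homog p (\sum_(t <- r | P t) F t).
Proof.
move=> h; apply/homogP => I hI; rewrite sum_ffunE big1 // => t /h /homogP; exact.
Qed.

Lemma homog_contre i p b : homog p b -> homog p.-1 (contre i b).
Proof.
move=> /homogP hb; apply/homogP => I hI; rewrite ffunE; case: ifPn => // iI.
by rewrite hb ?mulr0 // cardsU1 iI; apply: contra hI => /eqP <-.
Qed.

Lemma contre_homog0 i b : homog 0 b -> contre i b = 0.
Proof.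
move=> /homogP hb; apply/ffunP => I; rewrite !ffunE; case: ifPn => // iI.
by rewrite hb ?mulr0 // cardsU1 iI.
Qed.

Lemma ext_der_derivation (d : nat) phi : (forall i, homog d.+1 (phi i)) ->
  graded_derivation d (ext_der phi).
Proof.
move=> hphi; split; first exact: ext_derP.
  move=> [|p] b hb; apply: homog_sum => i _.
    by rewrite contre_homog0 // mulr0; apply/homogP => I _; rewrite ffunE.
  rewrite addSnnS addnC; apply: homogM => //; exact: homog_contre hb.
move=> p b c hb; rewrite /ext_der mulr_suml mulr_sumr scaler_sumr -big_split /=.
apply: eq_bigr => i _; rewrite contreM mulrDr mulrA (gsgnE hb); congr (_ + _).
rewrite -scalerAl -scalerAr !mulrA (homogC (hphi i) hb) -scalerAl scalerA.
congr (_ *: _); rewrite -exprD mulSn addnA exprD addnn -mul2n exprM sqrrN.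
by rewrite !expr1n mul1r.
Qed.

Lemma ext_der_e phi i : ext_der phi (gen i) = phi i.
Proof.
rewrite /ext_der (bigD1 i) //= contre_e eqxx mulr1 big1 ?addr0 // => j nij.
by rewrite contre_e (negPf nij) mulr0.
Qed.

Lemma ext_sum b : b = \sum_I b I *: ext_e K I.
Proof.
apply/ffunP => L; rewrite sum_ffunE (bigD1 L) //= big1 ?addr0 => [|I nI].
  by rewrite !ffunE eqxx; exact/esym/mulr1.
by rewrite !ffunE eq_sym (negPf nI) scaler0.
Qed.

Lemma graded_derivation_uniq (d : nat) D D' :
    graded_derivation d D -> graded_derivation d D' ->
  (forall i, D (gen i) = D' (gen i)) -> D =1 D'.
Proof.
move=> hD hD' eDD'; have [lD _ mD] := hD; have [lD' _ mD'] := hD'.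
pose HD := GRing.isLinear.Build K (ext K n) (ext K n) _ D lD.
pose HD' := GRing.isLinear.Build K (ext K n) (ext K n) _ D' lD'.
pose fD : {linear ext K n -> ext K n} := HB.pack D HD.
pose fD' : {linear ext K n -> ext K n} := HB.pack D' HD'.
have D1 E : graded_derivation d E -> E 1 = 0.
  case=> _ _ mE; have := mE 0%N 1 1; rewrite muln0 scale1r !mulr1 mul1r.
  have h1 : homog 0 (1 : ext K n) by have := homog_e set0; rewrite cards0.
  by move/(_ h1)/eqP; rewrite -subr_eq0 opprD addNKr oppr_eq0 => /eqP.
suff eI I : D (ext_e K I) = D' (ext_e K I).
  move=> b; rewrite (ext_sum b) -[LHS]/(fD _) -[RHS]/(fD' _) !linear_sum.
  by apply: eq_bigr => I _; rewrite !linearZ /= eI.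
have [m] := ubnP #|I|; elim: m I => // m IH I.
have [->|[i iI]] := set_0Vmem I; first by rewrite -[ext_e K _]/(1 : ext K n) (D1 _ hD) (D1 _ hD').
rewrite ltnS => hI.
have e : gen i * ext_e K (I :\ i) = (-1) ^+ ninv [set i] (I :\ i) *: ext_e K I.
  apply/ffunP => L; rewrite extME ffunE ffunE.
  have [->|nL] := eqVneq L I.
    rewrite (bigD1 [set i]) ?sub1set //= !ffunE !eqxx big1 ?addr0 => [|J /andP[_ nJ]].
      by rewrite mul1r.
    by rewrite ffunE (negPf nJ) mul0r mulr0.
  rewrite scaler0 big1 // => J JL; rewrite !ffunE.
  have [eJ|] := eqVneq J [set i]; last by rewrite mul0r mulr0.
  have [eL|] := eqVneq; last by rewrite !mulr0.
  case/eqP: nL; rewrite -(setD1K iI) -eL eJ setD1K //.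
  by rewrite -sub1set -eJ.
have -> : ext_e K I = (-1) ^+ ninv [set i] (I :\ i) *: (gen i * ext_e K (I :\ i)).
  by rewrite e scalerA -expr2 sqrr_sign scale1r.
rewrite -[LHS]/(fD _) -[RHS]/(fD' _) !linearZ /=; congr (_ *: _).
have hi := homog_gen i.
rewrite (mD _ _ _ hi) (mD' _ _ _ hi) eDD' IH //.
by apply: leq_trans hI; rewrite [leqRHS](cardsD1 i) iI.
Qed.

Lemma contrM v b c : contr v (b * c) = contr v b * c + gsgn b * contr v c.
Proof.
rewrite /contr mulr_suml mulr_sumr -big_split; apply: eq_bigr => i _ /=.
by rewrite contreM scalerDr scalerAl scalerAr.
Qed.

Lemma homog_covec v : homog 1 (covec v).
Proof.
apply: homog_sum => i _; apply/homogP => I hI; rewrite !ffunE.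
case: eqVneq => [eI|]; last by rewrite scaler0.
by rewrite eI cards1 in hI.
Qed.

Lemma contr_covec u v : contr u (covec v) = (v *m u^T) 0 0 *: 1.
Proof.
rewrite mxE scaler_suml /contr; apply: eq_bigr => i _.
rewrite /covec linear_sum (bigD1 i) //= linearZ /= contre_e eqxx big1 => [|j nji].
  by rewrite addr0 scalerA !mxE mulrC.
by rewrite linearZ /= contre_e eq_sym (negPf nji) scaler0.
Qed.

Lemma contr_prod u q (v : 'I_q.+1 -> 'rV[K]_n) :
  contr u (\prod_(a < q.+1) covec (v a)) =
    \sum_(a < q.+1) ((-1) ^+ a * (v a *m u^T) 0 0) *: \prod_(b < q) covec (v (lift a b)).
Proof.
elim: q v => [|q IH] v.
  by rewrite !big_ord_recl !big_ord0 mulr1 addr0 mul1r contr_covec.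
rewrite big_ord_recl contrM contr_covec IH -scalerAl mul1r.
rewrite [RHS]big_ord_recl mul1r; congr (_ + _).
rewrite (gsgnE (homog_covec _)) -scalerAl scaleN1r mulr_sumr -sumrN.
apply: eq_bigr => a _; rewrite [in RHS]big_ord_recl -scalerAr -scaleNr.
rewrite lift0 exprS mulN1r mulNr; congr (- (_ * _) *: _).
congr (covec (v _) * _); first exact/val_inj.
apply: eq_bigr => b _; congr (covec (v _)); apply/val_inj => /=.
by rewrite -[bump 0 a]/(a.+1) -[bump 0 b]/(b.+1) bumpS.
Qed.

Lemma foldl_contr_sum (T : finType) (s : seq 'rV[K]_n) (k : T -> K) (F : T -> ext K n) :
  foldl (fun c v => contr v c) (\sum_t k t *: F t) s set0
    = \sum_t k t * foldl (fun c v => contr v c) (F t) s set0.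
Proof.
elim: s F => [|v s IH] F /=.
  by rewrite sum_ffunE; apply: eq_bigr => t _; rewrite ffunE.
rewrite linear_sum (eq_bigr (fun t => k t *: contr v (F t))) /=; last first.
  by move=> t _; rewrite linearZ.
exact: IH.
Qed.

Lemma feval_det q (v w : 'I_q -> 'rV[K]_n) :
  feval (\prod_(a < q) covec (v a)) w = \det (\matrix_(a, b) (v a *m (w b)^T) 0 0).
Proof.
elim: q v w => [|q IH] v w.
  rewrite det_mx00 /feval /codom /image_mem enum_ord0 /= big_ord0.
  by rewrite -[1]/(ext_e K set0) ffunE eqxx.
rewrite /feval codomE enum_ordSl /= -map_comp contr_prod.
rewrite foldl_contr_sum (expand_det_col _ ord0); apply: eq_bigr => a _.
rewrite /cofactor addn0 mulrA [X in X * _]mulrC; congr (_ * _).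
  by rewrite [X in X * _ = _](_ : _ = (\matrix_(a, b) (v a *m (w b)^T) 0 0) a ord0) // [RHS]mxE.
have := IH (fun j => v (lift a j)) (w \o lift ord0); rewrite /feval codomE => e; apply: (etrans e).
by congr (\det _); apply/matrixP => j k; rewrite !mxE; apply: eq_bigr => l _; rewrite !mxE.
Qed.
End Forms.

From mathcomp Require Import boolp classical_sets.
Local Open Scope classical_set_scope.

Section Span.
Variables (K : fieldType) (V : vectType K).

(* [span] only takes finite sequences. *)
Definition setspan (S : set V) : {vspace V} :=
  xget 0%VS [set U : {vspace V} | (forall v, S v -> v \in U) /\
    (forall U' : {vspace V}, (forall v, S v -> v \in U') -> (U <= U')%VS)].

Lemma spanning_seq (S : set V) :
  exists2 s : seq V, (forall v, v \in s -> S v) & forall v, S v -> v \in <<s>>%VS.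
Proof.
pose P d := `[< exists2 s : seq V, (forall v, v \in s -> S v) & \dim <<s>> = d >].
have exP : exists d, P d.
  by exists 0%N; apply/asboolP; exists [::] => //; rewrite span_nil dimv0.
have ubP d : P d -> (d <= dim V)%N.
  by case/asboolP => s _ <-; rewrite -dimvf dimvS // subvf.
case: (ex_maxnP exP ubP) => m /asboolP[s sS dims] maxm; exists s => // v Sv.
have le : (<<s>> <= <<v :: s>>)%VS.
  by apply: sub_span => x; rewrite inE => ->; rewrite orbT.
have : (<<s>> == <<v :: s>>)%VS.
  rewrite eqEdim le dims; apply: maxm; apply/asboolP; exists (v :: s) => //.
  by move=> x; rewrite inE => /orP[/eqP ->//|/sS].
by move/eqP => ->; apply: memv_span; rewrite inE eqxx.
Qed.

Lemma setspanP (S : set V) :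
  (forall v, S v -> v \in setspan S) /\
  (forall U : {vspace V}, (forall v, S v -> v \in U) -> (setspan S <= U)%VS).
Proof.
have [s sS Ss] := spanning_seq S.
rewrite /setspan; case: xgetP => [U _ //|/(_ <<s>>%VS) []].
by split=> // U hU; apply/span_subvP => v /sS /hU.
Qed.

Lemma mem_setspan_closed (S : set V) :
    S 0 -> (forall (k : K) u v, S u -> S v -> S (k *: u + v)) ->
  forall v, v \in setspan S <-> S v.
Proof.
move=> S0 Slin v; have [subS minS] := setspanP S; split; last exact: subS.
have [s sS Ss] := spanning_seq S.
move/(subvP (minS _ Ss)) => vs; rewrite (coord_span (X := in_tuple s) vs).
elim/big_rec: _ => // i u _ Su; apply: Slin => //.
by apply: sS; apply: mem_nth.
Qed.

End Span.

Section Ordinary.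
Variables (K : fieldType) (n : nat).
Local Notation T := 'rV[K]_n.

Definition Dgl (zeta : 'End(T)) : ext K n -> ext K n :=
  ext_der (fun i => covec (zeta (delta_mx 0 i))).

Lemma Dgl_derivation zeta : graded_derivation 0 (Dgl zeta).
Proof. by apply: ext_der_derivation => i; apply: homog_covec. Qed.

Lemma Dgl_covec zeta v : Dgl zeta (covec v) = covec (zeta v).
Proof.
have lin_covec : linear (@covec K n).
  move=> k x y; rewrite /covec scaler_sumr -big_split; apply: eq_bigr => i _ /=.
  by rewrite !mxE scalerDl scalerA.
have [lD _ _] := Dgl_derivation zeta.
pose HD := GRing.isLinear.Build K (ext K n) (ext K n) _ (Dgl zeta) lD.
pose fD : {linear ext K n -> ext K n} := HB.pack (Dgl zeta) HD.
pose HC := GRing.isLinear.Build K T (ext K n) _ (@covec K n) lin_covec.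
pose fC : {linear T -> ext K n} := HB.pack (@covec K n) HC.
rewrite [v in RHS]row_sum_delta linear_sum -[RHS]/(fC _) linear_sum.
rewrite -[LHS]/(fD _) /covec linear_sum; apply: eq_bigr => i _.
by rewrite !linearZ /= /Dgl ext_der_e.
Qed.

Lemma linear_feval_Dgl beta q (w : 'I_q -> T) :
  linear (fun zeta => feval (Dgl zeta beta) w : K^o).
Proof.
move=> k z1 z2; rewrite -[X in _ = X + _]/(k * feval (Dgl z1 beta) w).
pose F (t : bool) := Dgl (if t then z1 else z2) beta.
have -> : Dgl (k *: z1 + z2) beta = \sum_(t : bool) (if t then k else 1) *: F t.
  rewrite big_bool scale1r /F /Dgl /ext_der scaler_sumr -big_split.
  apply: eq_bigr => i _ /=; rewrite scalerAl -mulrDl; congr (_ * _).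
  rewrite /covec scaler_sumr -big_split; apply: eq_bigr => j _ /=.
  by rewrite add_lfunE scale_lfunE !mxE scalerDl scalerA.
by rewrite /feval foldl_contr_sum big_bool mul1r.
Qed.

Definition gl_dot (alpha : ext K n) : set (ext K n) :=
  [set Dgl zeta alpha | zeta in setT].

(* gl(T) (x) T in coordinates: [eta (i, j, k)] is eta_ijk. *)
Definition glT := {ffun 'I_n * 'I_n * 'I_n -> K^o}.

Definition deta (eta : glT) : ext K n -> ext K n :=
  ext_der (fun i => - \sum_j \sum_k
    eta (i, j, k) *: (gen K k * gen K j)).

Lemma deta_derivation eta : graded_derivation 1 (deta eta).
Proof.
apply: ext_der_derivation => i; rewrite -sumrN; apply: homog_sum => j _.
rewrite -sumrN; apply: homog_sum => k _; rewrite -scaleNr.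
have h : homog 2 (gen K k * gen K j).
  by apply: (@homogM _ _ 1 1); apply: homog_gen.
by apply/homogP => I; move/homogP: h => h /h hI; rewrite [LHS]ffunE hI scaler0.
Qed.

Section RestrictedForms.
Variables (E : {vspace T}) (p : nat).

Definition upd (w : 'I_p -> subvs_of E) (i : 'I_p) (u : subvs_of E) :=
  fun j => if j == i then u else w j.

(* Lambda^p E is encoded as the set of alternating p-linear forms on E, so that
   pi_E is the restriction [restr] of forms to vectors of E. *)
Definition altforms : set (('I_p -> subvs_of E) -> K) :=
  [set f |
    (forall (w : 'I_p -> subvs_of E) i k u v, f (upd w i (k *: u + v))
       = k * f (upd w i u) + f (upd w i v)) /\
    (forall (w : 'I_p -> subvs_of E) i j, i != j -> w i = w j -> f w = 0)].

Definition restr (b : ext K n) : ('I_p -> subvs_of E) -> K :=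
  fun w => feval b (vsval \o w).

Definition stable (alpha : ext K n) : Prop :=
  restr @` gl_dot alpha = altforms.

End RestrictedForms.

(* The subspace underlying a subalgebra of the exterior algebra. *)
Variable A : {vspace ext K n}.

Definition c_functionals (W : {vspace T}) : set 'Hom('End(T), K^o) :=
  [set f | exists q beta (w : 'I_q -> T),
    [/\ (1 <= q)%N, beta \in A, homog q beta, forall a, w a \in W
      & forall zeta, f zeta = feval (Dgl zeta beta) w]].

Definition c_dim (W : {vspace T}) : nat :=
  \dim (setspan (c_functionals W)).

Definition ZA0 : {vspace glT} :=
  setspan [set eta | forall beta, beta \in A -> deta eta beta = 0].

Lemma mem_ZA0 eta :
  eta \in ZA0 <-> forall beta, beta \in A -> deta eta beta = 0.
Proof.
apply: (mem_setspan_closed (S := [set eta | forall beta, _ -> deta eta beta = 0])).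
  move=> beta _; rewrite /deta /ext_der big1 // => i _.
  rewrite big1 ?oppr0 ?mul0r // => j _; rewrite big1 // => k _.
  by rewrite ffunE scale0r.
move=> c u v hu hv beta bA.
suff -> : deta (c *: u + v) beta = c *: deta u beta + deta v beta.
  by rewrite hu // hv // scaler0 addr0.
rewrite /deta /ext_der scaler_sumr -big_split; apply: eq_bigr => i _ /=.
rewrite scalerAl -mulrDl scalerN scaler_sumr -opprD -big_split; congr (- _ * _).
apply: eq_bigr => j _ /=; rewrite scaler_sumr -big_split; apply: eq_bigr => k _ /=.
by rewrite !ffunE scalerDl scalerA.
Qed.

(* Complete flags W 0 < W 1 < ... < W n; the values of W beyond n are
   irrelevant. *)
Definition flag (W : nat -> {vspace T}) : Prop :=
  (forall i, (i <= n)%N -> \dim (W i) = i) /\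
  (forall i, (i < n)%N -> (W i <= W i.+1)%VS /\ W i <> W i.+1).

(* I_A-ordinary flags; the right-hand side is dim (gl(T) (x) T / Z_{A,0}). *)
Definition ordinary (W : nat -> {vspace T}) : Prop :=
  (\sum_(i < n) c_dim (W i) = \dim {:glT} - \dim ZA0)%N.

End Ordinary.

(* Main.v *)
From HB Require Import structures.
Require Import Defs.
From mathcomp Require Import all_boot all_algebra all_field.
From mathcomp Require Import reals.

Set Implicit Arguments.
Unset Strict Implicit.
Unset Printing Implicit Defensive.
Import GRing.Theory.

(** The derivation d_eta is a sum of operators e^j /\ D_zeta, and every
    alpha |-> u /\ D_zeta alpha is of the form d_eta.  Since d_eta is a
    derivation, it kills the algebra A generated by alpha as soon as it kills
    alpha, so the codimension of Z_{A,0} is the dimension of T /\ V, where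
    V = gl(T) . alpha.

    Let nu be a covector cutting out the hyperplane E.  A form that vanishes on
    E is a multiple of nu, and is killed by nu.  As V restricts onto all forms
    on E, this gives first nu /\ V = nu /\ Lambda^p T, then
    T /\ V = Lambda^(p+1) T: any beta is v + nu /\ gamma with v in V, and
    u /\ nu /\ gamma lies in nu /\ Lambda^p T ([wedge_in_limg_deta]).  Hence
    the codimension is 'C(n, p.+1) ([codim_ZA0]).

    On the other side let W be a subspace of E.  By the Leibniz rule, if
    D_zeta alpha vanishes on W then so does D_zeta beta for every beta in A.
    So the functionals counted by c(W) are those of Lambda^p W composed with
    zeta |-> (D_zeta alpha)|_W, which is onto by stability, and c(W) is
    'C(dim W, p) ([c_dim_stable]).  The binomials 'C(i, p) for i < n add up to
    'C(n, p.+1).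

    Everything but the final statement holds over an arbitrary field. *)

Section Restriction.
Local Open Scope ring_scope.
Variables (K : fieldType) (n : nat).
Local Notation T := 'rV[K]_n.
Implicit Types (b c : ext K n) (u v x : T) (s : seq T) (U : {vspace T}).

(** * Contractions and degrees *)

Lemma contre_sq i b : contre i (contre i b) = 0.
Proof. by apply/ffunP => L; rewrite !ffunE setU11 mulr0; case: ifP. Qed.

Lemma contreC i j b : contre i (contre j b) = - contre j (contre i b).
Proof.
have [<-|nij] := eqVneq i j; first by rewrite contre_sq oppr0.
apply/ffunP => L; rewrite !ffunE !inE [j == i]eq_sym (negPf nij) /=.
case: (boolP (i \in L)) => iL; case: (boolP (j \in L)) => jL;
  rewrite ?mulr0 ?oppr0 //.
rewrite setUCA !mulrA -mulNr; congr (_ * _).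
rewrite !ninvUr ?disjoints1 // !exprD.
have dij : [disjoint [set i] & [set j]] by rewrite disjoints1 inE.
have := congr1 odd (ninvC dij); rewrite !cards1 oddD.
rewrite -[(-1) ^+ ninv [set j] [set i]]signr_odd.
rewrite -[(-1) ^+ ninv [set i] [set j]]signr_odd.
by case: (odd _); case: (odd _) => // _;
  rewrite ?expr1 ?expr0 ?mulN1r ?mul1r ?mulrN ?mulNr ?opprK mulrC.
Qed.

Lemma contrC u v b : contr u (contr v b) = - contr v (contr u b).
Proof.
rewrite /contr -sumrN.
under eq_bigr => i _ do rewrite linear_sum scaler_sumr.
rewrite exchange_big; apply: eq_bigr => j _.
rewrite linear_sum scaler_sumr -sumrN; apply: eq_bigr => i _.
by rewrite !linearZ /= [in LHS]contreC !scalerA !scalerN [v 0 j * _]mulrC.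
Qed.

(** Antisymmetry alone does not give this in characteristic 2: the terms of the
    double sum cancel in pairs off the diagonal and vanish on it. *)
Lemma contr_sq v b : contr v (contr v b) = 0.
Proof.
pose F i j := (v 0 i * v 0 j) *: contre i (contre j b).
have -> : contr v (contr v b) = \sum_i \sum_j F i j.
  apply: eq_bigr => i _; rewrite linear_sum scaler_sumr.
  by apply: eq_bigr => j _; rewrite linearZ /= scalerA.
have -> : \sum_i \sum_j F i j
    = \sum_(i : 'I_n) \sum_(j : 'I_n | (j < i)%N) F i j
    + \sum_(i : 'I_n) \sum_(j : 'I_n | (i < j)%N) F i j.
  rewrite -big_split; apply: eq_bigr => i _ /=.
  rewrite (bigD1 i) //= /F contre_sq scaler0 add0r.
  rewrite (bigID (fun j : 'I_n => (j < i)%N)) /=.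
  by congr (_ + _); apply: eq_bigl => j; rewrite -val_eqE /=; case: ltngtP.
rewrite [X in _ + X](exchange_big_dep xpredT) //= -big_split big1 //= => i _.
rewrite -big_split big1 //= => j _.
by rewrite /F contreC scalerN [v 0 j * _]mulrC addNr.
Qed.

Lemma contrDv k u v b : contr (k *: u + v) b = k *: contr u b + contr v b.
Proof.
rewrite /contr scaler_sumr -big_split; apply: eq_bigr => i _ /=.
by rewrite !mxE scalerDl scalerA.
Qed.

Lemma contr_delta i b : contr (delta_mx 0 i) b = contre i b.
Proof.
rewrite /contr (bigD1 i) //= mxE !eqxx scale1r big1 ?addr0 // => j nji.
by rewrite mxE eqxx (negPf nji) scale0r.
Qed.

Lemma gsgnD b c : gsgn (b + c) = gsgn b + gsgn c.
Proof. by apply/ffunP => L; rewrite !ffunE mulrDr. Qed.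

Lemma gsgnZ k b : gsgn (k *: b) = k *: gsgn b.
Proof. by apply/ffunP => L; rewrite !ffunE scalerAr. Qed.

Lemma gsgn_sum (I : finType) (F : I -> ext K n) :
  gsgn (\sum_i F i) = \sum_i gsgn (F i).
Proof.
apply: (big_morph (@gsgn K n) gsgnD); apply/ffunP => L.
by rewrite !ffunE mulr0.
Qed.

Lemma contr_gsgn v b : contr v (gsgn b) = - gsgn (contr v b).
Proof.
rewrite /contr gsgn_sum -sumrN; apply: eq_bigr => i _.
rewrite gsgnZ -scalerN; congr (_ *: _); apply/ffunP => L; rewrite !ffunE.
case: ifPn => iL; first by rewrite mulr0 oppr0.
by rewrite cardsU1 iL exprS mulN1r mulNr mulrN mulrCA.
Qed.

Lemma homogD p b c : homog p b -> homog p c -> homog p (b + c).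
Proof.
move=> /homogP hb /homogP hc; apply/homogP => I hI.
by rewrite ffunE hb ?hc ?addr0.
Qed.

Lemma homogZ p k b : homog p b -> homog p (k *: b).
Proof.
by move=> /homogP hb; apply/homogP => I /hb hI; rewrite ffunE hI scaler0.
Qed.

Lemma homog_contr v p b : homog p b -> homog p.-1 (contr v b).
Proof. by move=> hb; apply: homog_sum => i _; apply/homogZ/homog_contre. Qed.

Lemma contr_homog0 v b : homog 0 b -> contr v b = 0.
Proof.
by move=> hb; rewrite /contr big1 // => i _; rewrite contre_homog0 // scaler0.
Qed.

Lemma homog1 : homog 0 (1 : ext K n).
Proof. by have := homog_e K (set0 : {set 'I_n}); rewrite cards0. Qed.

Lemma homog_prod q (v : 'I_q -> T) : homog q (\prod_(a < q) covec (v a)).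
Proof.
elim: q v => [|q IH] v.
  by rewrite big_ord0; apply: homog1.
rewrite big_ord_recl; apply: (@homogM _ _ 1 q); first exact: homog_covec.
exact: IH.
Qed.

Lemma covec_delta (i : 'I_n) : covec (delta_mx 0 i) = gen K i.
Proof.
rewrite /covec (bigD1 i) //= mxE !eqxx scale1r big1 ?addr0 // => j nji.
by rewrite mxE (negPf nji) andbF scale0r.
Qed.

Lemma ext_eD1 (I : {set 'I_n}) i : i \in I ->
  gen K i * ext_e K (I :\ i) = (-1) ^+ ninv [set i] (I :\ i) *: ext_e K I.
Proof.
move=> iI; apply/ffunP => L; rewrite extME !ffunE.
have [->|nL] := eqVneq L I.
  rewrite (bigD1 [set i]) ?sub1set //= !ffunE !eqxx big1 => [|J /andP[_ nJ]].
    by rewrite addr0 mul1r.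
  by rewrite ffunE (negPf nJ) mul0r mulr0.
rewrite scaler0 big1 // => J JL; rewrite !ffunE.
have [eJ|] := eqVneq J [set i]; last by rewrite mul0r mulr0.
have [eL|] := eqVneq; last by rewrite !mulr0.
by case/eqP: nL; rewrite -(setD1K iI) -eL eJ setD1K // -sub1set -eJ.
Qed.

(** * Forms vanishing on a subspace *)

Definition evs b s : K := foldl (fun c v => contr v c) b s set0.

Lemma evsP k b c s : evs (k *: b + c) s = k * evs b s + evs c s.
Proof.
elim: s b c => [|v s IH] b c; first by rewrite /evs /= !ffunE.
by rewrite /evs /= linearP; apply: IH.
Qed.

Lemma evs0 s : evs 0 s = 0.
Proof. by elim: s => [|v s IH]; rewrite /evs /= ?linear0 ?ffunE. Qed.

Lemma evsN b s : evs (- b) s = - evs b s.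
Proof. by have := evsP (-1) b 0 s; rewrite scaleN1r addr0 mulN1r evs0 addr0. Qed.

Lemma evs_cons b v s : evs b (v :: s) = evs (contr v b) s.
Proof. by []. Qed.

Lemma evs_cat b s1 s2 :
  evs b (s1 ++ s2) = evs (foldl (fun c v => contr v c) b s1) s2.
Proof. by rewrite /evs foldl_cat. Qed.

Lemma evs_homog p b s : homog p b -> size s != p -> evs b s = 0.
Proof.
elim: s p b => [|v s IH] [|p] b hb //= ne.
- by move/homogP: hb; apply; rewrite cards0.
- by rewrite evs_cons contr_homog0 // evs0.
- apply: (IH p); last by rewrite eqSS in ne.
  exact: (homog_contr v hb).
Qed.

Lemma feval_evs b q (w : 'I_q -> T) : feval b w = evs b (codom w).
Proof. by []. Qed.

(** All degrees are tested at once: b vanishes on U when each of its homogeneous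
    components has zero restriction to U.  This makes vanishing compatible with
    contraction and multiplication without tracking degrees. *)
Definition nullon U b := forall s, {subset s <= U} -> evs b s = 0.

Lemma nullonP U b :
  nullon U b <-> b set0 = 0 /\ forall u, u \in U -> nullon U (contr u b).
Proof.
split=> [h|[h0 hS] [|u s] sU //].
  split=> [|u uU s sU]; first exact: (h [::]).
  by apply: (h (u :: s)) => x; rewrite inE => /predU1P[->|/sU].
apply: (hS u); first by apply: sU; rewrite mem_head.
by move=> x xs; apply: sU; rewrite inE xs orbT.
Qed.

Lemma nullon_lin U k b c : nullon U b -> nullon U c -> nullon U (k *: b + c).
Proof. by move=> hb hc s sU; rewrite evsP hb // hc // mulr0 addr0. Qed.

Lemma nullon0 U : nullon U 0.
Proof. by move=> s _; apply: evs0. Qed.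

Lemma nullonD U b c : nullon U b -> nullon U c -> nullon U (b + c).
Proof. by move=> hb hc; rewrite -[b]scale1r; apply: nullon_lin. Qed.

Lemma nullonN U b : nullon U b -> nullon U (- b).
Proof. by move=> hb s sU; rewrite evsN hb // oppr0. Qed.

Lemma nullon_gsgn U b : nullon U b -> nullon U (gsgn b).
Proof.
move=> hb s; elim: s b hb => [|u s IH] b /nullonP[b0 hb] sU.
  by rewrite /evs /= ffunE b0 mulr0.
rewrite evs_cons contr_gsgn evsN IH ?oppr0 //.
  by apply: hb; apply: sU; rewrite mem_head.
by move=> x xs; apply: sU; rewrite inE xs orbT.
Qed.

Lemma ext_mul0E b c : (b * c) set0 = b set0 * c set0.
Proof.
rewrite extME (bigD1 set0) ?sub0set //= ninv0l mul1r setD0 big1 ?addr0 //.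
by move=> I /andP[]; rewrite subset0 => ->.
Qed.

(** Forms vanishing on U are the kernel of the restriction to U, hence a
    two-sided ideal; the induction contracts the product one vector at a time,
    which is where stability under the sign [gsgn] enters. *)
Lemma nullonMl U b c : nullon U b -> nullon U (b * c).
Proof.
move=> hb s; elim: s b c hb => [|u s IH] b c hb sU.
  by have [b0 _] := (nullonP U b).1 hb; rewrite /evs /= ext_mul0E b0 mul0r.
have uU : u \in U by apply: sU; rewrite mem_head.
have sU' : {subset s <= U} by move=> x xs; apply: sU; rewrite inE xs orbT.
rewrite evs_cons contrM -[contr u b * c]scale1r evsP mul1r.
rewrite !IH ?addr0 //; first exact: nullon_gsgn.
exact: ((nullonP U b).1 hb).2.
Qed.

Lemma nullonMr U b c : nullon U c -> nullon U (b * c).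
Proof.
move=> hc s; elim: s b c hc => [|u s IH] b c hc sU.
  by have [c0 _] := (nullonP U c).1 hc; rewrite /evs /= ext_mul0E c0 mulr0.
have uU : u \in U by apply: sU; rewrite mem_head.
have sU' : {subset s <= U} by move=> x xs; apply: sU; rewrite inE xs orbT.
rewrite evs_cons contrM -[contr u b * c]scale1r evsP mul1r.
rewrite !IH ?addr0 //; exact: ((nullonP U c).1 hc).2.
Qed.

(** When a list of vectors of U + <x> is expanded, only the terms with x at most
    once survive, because contracting twice with x gives zero. *)
Lemma nullon_adjoin U x b :
  nullon U b -> nullon U (contr x b) -> nullon (U + <[x]>)%VS b.
Proof.
move=> + + s; elim: s b => [|v s IH] b hb hx sU; first exact: hb.
have /memv_addP[u uU [_ /vlineP[k ->] ->]] : v \in (U + <[x]>)%VS.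
  by apply: sU; rewrite mem_head.
have hbS := ((nullonP U _).1 hb).2; have hxS := ((nullonP U _).1 hx).2.
rewrite evs_cons addrC contrDv; apply: IH.
- by apply: nullon_lin => //; apply: hbS.
- rewrite linearP /= contr_sq scaler0 add0r contrC; apply: nullonN; exact: hxS.
by move=> y ys; apply: sU; rewrite inE ys orbT.
Qed.

(** Sublists of X suffice, by adjoining the vectors of X one at a time: the
    sublists with x give the contraction with x, the others the form itself. *)
Lemma nullon_span (X : seq T) b :
  (forall s, subseq s X -> evs b s = 0) -> nullon <<X>>%VS b.
Proof.
elim: X b => [|x X IH] b hX.
  rewrite span_nil => s; elim: s => [|v s _] sU; first exact: hX.
  have /eqP-> : v == 0 by rewrite -memv0; apply: sU; rewrite mem_head.
  rewrite evs_cons; suff -> : contr 0 b = 0 by apply: evs0.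
  by rewrite /contr big1 // => i _; rewrite mxE scale0r.
rewrite span_cons addvC; apply: nullon_adjoin; apply: IH => s sX.
  by apply: hX; apply: subseq_trans sX (subseq_cons _ _).
by apply: (hX (x :: s)); rewrite /= eqxx.
Qed.

Lemma nullon_fullv b : nullon fullv b -> b = 0.
Proof.
move=> hb; apply/ffunP => I; rewrite [RHS]ffunE.
have [m] := ubnP #|I|; elim: m I b hb => // m IH I b /nullonP[b0 hb].
have [->//|[i iI]] := set_0Vmem I.
rewrite (cardsD1 i) iI ltnS => hI.
have := IH _ _ (hb (delta_mx 0 i) (memvf _)) hI.
rewrite contr_delta ffunE !inE eqxx setD1K // => /eqP.
by rewrite mulf_eq0 signr_eq0 => /eqP.
Qed.

Lemma contr_covec_mul nu x b : (nu *m x^T) 0 0 = 1 ->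
  contr x (covec nu * b) = b - covec nu * contr x b.
Proof.
move=> h; rewrite contrM contr_covec h scale1r mul1r.
by rewrite (gsgnE (homog_covec nu)) expr1 scaleN1r mulNr.
Qed.

Lemma nullon_covec U nu :
  (forall u, u \in U -> (nu *m u^T) 0 0 = 0) -> nullon U (covec nu).
Proof.
move=> h; apply/nullonP; split=> [|u uU].
  by have /homogP := homog_covec nu; apply; rewrite cards0.
by rewrite contr_covec h // scale0r; apply: nullon0.
Qed.

(** The product nu /\ b vanishes on U because nu does, and its contraction with x
    is b - nu /\ (x contracted with b), which also vanishes on U; hence it
    vanishes on U + <x> = T. *)
Lemma nullon_mul0 U nu x b :
    (forall u, u \in U -> (nu *m u^T) 0 0 = 0) -> (nu *m x^T) 0 0 = 1 ->
    (U + <[x]>)%VS = fullv ->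
  nullon U b -> covec nu * b = 0.
Proof.
move=> nuU nux fullUx hb; have hnu c : nullon U (covec nu * c).
  by apply/nullonMl/nullon_covec.
apply: nullon_fullv; rewrite -fullUx; apply: nullon_adjoin => //.
by rewrite contr_covec_mul //; apply: nullonD => //; apply: nullonN.
Qed.

(** * Restrictions are alternating *)

Lemma enum_split p (i : 'I_p) : exists s1 s2 : seq 'I_p,
  [/\ enum 'I_p = s1 ++ i :: s2, i \notin s1 & i \notin s2].
Proof.
have := enum_uniq 'I_p; case/splitPr: (mem_enum 'I_p i) => s1 s2.
rewrite cat_uniq /= negb_or => /and4P[_ /andP[i1 _] i2 _].
by exists s1, s2; split.
Qed.

(** The scalar k is carried along so that the induction absorbs the signs. *)
Lemma foldl_contr_comm k u s b :
  foldl (fun c v => contr v c) (k *: contr u b) s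
    = ((-1) ^+ size s * k) *: contr u (foldl (fun c v => contr v c) b s).
Proof.
elim: s k b => [|v s IH] k b /=; first by rewrite mul1r.
by rewrite linearZ /= contrC scalerN -scaleNr IH exprS mulN1r mulrN mulNr.
Qed.

Lemma evs_repeat b u s1 s2 s3 : evs b (s1 ++ u :: s2 ++ u :: s3) = 0.
Proof.
rewrite evs_cat -cat_cons evs_cat /=.
rewrite -[contr u _]scale1r foldl_contr_comm.
by rewrite evs_cons linearZ /= contr_sq scaler0 evs0.
Qed.

Lemma restr_altforms (E : {vspace T}) p b : altforms (restr (E := E) (p := p) b).
Proof.
split=> [w i k u v|w i j nij eij].
  have [s1 [s2 [es i1 i2]]] := enum_split i.
  pose f j := vsval (w j).
  have hf (t : seq 'I_p) (u' : subvs_of E) :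
      i \notin t -> map (vsval \o upd w i u') t = map f t.
    move=> it; apply/eq_in_map => j jt; rewrite /= /upd ifN //.
    by apply: contraNneq it => <-.
  have eu (u' : subvs_of E) :
      codom (vsval \o upd w i u') = map f s1 ++ vsval u' :: map f s2.
    by rewrite codomE es map_cat /= !hf // /upd eqxx.
  by rewrite /restr !feval_evs !eu !evs_cat linearP /evs /= contrDv; apply: evsP.
rewrite /restr feval_evs codomE; have [s1 [s2 [es i1 i2]]] := enum_split i.
have := mem_enum 'I_p j; rewrite es mem_cat inE [j == i]eq_sym (negPf nij) /=.
case/orP => js; case/splitPr: js => t1 t2.
  by rewrite -catA /= !map_cat /= map_cat /= eij evs_repeat.
by rewrite !map_cat /= map_cat /= eij evs_repeat.
Qed.

(** * Forms dual to a basis *)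

Definition dualcovec m (X : m.-tuple T) (a : 'I_m) : T :=
  \row_j coord X a (delta_mx 0 j).

Lemma dualcovecE m (X : m.-tuple T) a u :
  (dualcovec X a *m u^T) 0 0 = coord X a u.
Proof.
rewrite [u in RHS]row_sum_delta linear_sum mxE; apply: eq_bigr => j _.
by rewrite linearZ !mxE mulrC.
Qed.

Definition subfamily m (X : m.-tuple T) (J : {set 'I_m}) : seq T :=
  [seq X`_a | a : 'I_m <- enum J].

Lemma subseq_subfamily m (X : m.-tuple T) s :
  subseq s X -> exists J, s = subfamily X J.
Proof.
have eX : X = [seq X`_a | a : 'I_m <- enum 'I_m] :> seq T.
  by rewrite -[LHS]map_tnth_enum; apply: eq_map => a; rewrite (tnth_nth 0).
rewrite {1}eX => /subseqP[k _ ->]; exists [set a in mask k (enum 'I_m)].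
rewrite -map_mask /subfamily; congr (map _ _).
rewrite [LHS](elimT (subseq_uniqP (enum_uniq _)) (mask_subseq _ _)).
by rewrite [RHS]/enum_mem -enumT; apply: eq_filter => a; rewrite !inE.
Qed.

Lemma evs_feval b s q : size s = q -> evs b s = feval b (fun a : 'I_q => nth 0 s a).
Proof.
move=> <-; rewrite feval_evs codomE; congr (evs _ _).
rewrite [RHS](map_comp (nth 0 s) val) val_enum_ord.
by rewrite -[LHS](mkseq_nth 0).
Qed.

Definition dualform m (X : m.-tuple T) (J : {set 'I_m}) : ext K n :=
  \prod_(a < #|J|) covec (dualcovec X (enum_val a)).

(** The value is the determinant of the matrix of coordinates: the identity when
    I = J, and otherwise the row of an element of J that is not in I is zero. *)
Lemma evs_dualform m (X : m.-tuple T) (I J : {set 'I_m}) : free X ->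
  #|I| = #|J| -> evs (dualform X J) (subfamily X I) = (I == J)%:R.
Proof.
move=> freeX eIJ.
rewrite (@evs_feval _ _ #|J|) ?size_map -?cardE // feval_det.
set M := \matrix_(_, _) _.
have ME (a b : 'I_#|J|) : exists2 c, c \in I &
    M a b = (c == enum_val a)%:R /\ (I = J -> c = enum_val b :> 'I_m).
  have bI : (b < size (enum I))%N by rewrite -cardE eIJ.
  pose c := nth (enum_val b) (enum I) b; exists c.
    by rewrite -mem_enum mem_nth.
  rewrite mxE dualcovecE /subfamily (nth_map (enum_val b)) // coord_free //.
  by split=> // eq; rewrite /c eq -enum_val_nth.
have [eq|nIJ] := eqVneq I J.
  suff -> : M = 1%:M by rewrite det1.
  apply/matrixP => a b; have [c _ [-> /(_ eq) ->]] := ME a b.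
  by rewrite mxE (inj_eq enum_val_inj) eq_sym.
have /subsetPn[c cJ cI] : ~~ (J \subset I).
  by apply: contra nIJ => JI; rewrite eq_sym eqEcard JI eIJ /=.
rewrite (expand_det_row _ (enum_rank_in cJ c)) big1 // => b _.
have [d dI [-> _]] := ME (enum_rank_in cJ c) b.
rewrite enum_rankK_in //; case: eqP => [ed|]; last by rewrite mul0r.
by rewrite -ed dI in cI.
Qed.

(** The family f is free because z is dual to it, and spans S because v minus
    the sum of the f_i(v) z_i is killed by every f_i. *)
Lemma dim_setspan_dual (V : vectType K) (S : 'Hom(V, K^o) -> Prop) N
    (f : 'I_N -> 'Hom(V, K^o)) (z : 'I_N -> V) :
    (forall i, S (f i)) -> (forall i j, f i (z j) = (i == j)%:R) ->
    (forall g, S g -> forall v : V, (forall i, f i v = 0) -> g v = 0) ->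
  \dim (setspan S) = N.
Proof.
move=> Sf fz Sker; pose X := [tuple f i | i < N].
have XE (i : 'I_N) : X`_i = f i by rewrite -tnth_nth tnth_mktuple.
have freeX : free X.
  apply/freeP => k k0 j; move/lfunP/(_ (z j)): k0.
  rewrite sum_lfunE (bigD1 j) //= scale_lfunE XE fz eqxx zero_lfunE.
  rewrite big1 => [|i nij]; first by rewrite addr0 => <-; rewrite [RHS]mulr1.
  by rewrite scale_lfunE XE fz (negPf nij) scaler0.
suff -> : setspan S = <<X>>%VS by rewrite (eqP freeX) size_tuple.
have [subS minS] := setspanP S; apply/eqP; rewrite eqEsubv; apply/andP; split.
  apply: minS => g Sg.
  suff -> : g = \sum_i g (z i) *: f i.
    apply: rpred_sum => i _; apply/rpredZ/memv_span.
    by apply/tnthP; exists i; rewrite tnth_mktuple.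
  apply/lfunP => y; apply/eqP; rewrite -subr_eq0.
  have /(Sker _ Sg) : forall i, f i (y - \sum_j f j y *: z j) = 0.
    move=> i; rewrite linearB linear_sum (bigD1 i) //= linearZ /= fz eqxx.
    rewrite big1 => [|j nji]; last by rewrite linearZ /= fz eq_sym (negPf nji) scaler0.
    by rewrite addr0 -[_ *: _]/(_ * _) mulr1 subrr.
  rewrite linearB linear_sum /= => /eqP; rewrite sum_lfunE.
  set A := \sum_i _; set B := \sum_i _; suff -> : A = B by [].
  by apply: eq_bigr => i _; rewrite linearZ scale_lfunE [LHS]mulrC.
by apply/span_subvP => g /tnthP[i ->]; rewrite tnth_mktuple; apply: subS.
Qed.

(** * The polar spaces of a stable form *)

Lemma restr_nullon (E : {vspace T}) p b : homog p b ->
  (forall w : 'I_p -> subvs_of E, restr b w = 0) -> nullon E b.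
Proof.
move=> hb hw s sE; have [ep|/(evs_homog hb) //] := eqVneq (size s) p.
rewrite (evs_feval _ ep) -(hw (fun a => vsproj E (nth 0 s a))).
rewrite /restr !feval_evs; congr (evs _ _); apply: eq_codom => a /=.
by rewrite vsprojK // sE // mem_nth // ep.
Qed.

Lemma homog_Dgl zeta p b : homog p b -> homog p (Dgl zeta b).
Proof. by have [_ h _] := Dgl_derivation zeta; move=> /h; rewrite addn0. Qed.

Lemma stable_lift (E : {vspace T}) p alpha : homog p alpha -> stable E p alpha ->
  forall b, homog p b -> exists zeta, nullon E (Dgl zeta alpha - b).
Proof.
move=> ha st b hb; have := restr_altforms E p b.
rewrite -st => -[_ [zeta _ <-] e]; exists zeta.
apply: (@restr_nullon _ p).
  by rewrite -scaleN1r; apply: homogD; [apply: homog_Dgl|apply: homogZ].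
move=> w; rewrite /restr !feval_evs addrC -scaleN1r evsP mulN1r.
by rewrite -!feval_evs -[feval b _]/(restr b w) -e addNr.
Qed.

(** Derivations kill scalars, whereas there are nonzero forms of degree 0. *)
Lemma stable_gt0 (E : {vspace T}) p alpha :
  homog p alpha -> stable E p alpha -> (0 < p)%N.
Proof.
case: p => // ha st.
have : altforms (fun w : 'I_0 -> subvs_of E => 1) by split => [w []|w []].
rewrite -st => -[_ [zeta _ <-]] /(congr1 (fun f => f (fun _ => 0))) /eqP.
rewrite /restr /Dgl /ext_der big1 => [|i _]; last by rewrite contre_homog0 ?mulr0.
by rewrite feval_evs evs0 eq_sym oner_eq0.
Qed.

(** The algebra generated by alpha is the least subspace that contains 1 and is
    stable under multiplication by alpha. *)
Lemma agenv_line_ind (P : ext K n -> Prop) alpha : P 0 ->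
    (forall k b c, P b -> P c -> P (k *: b + c)) -> P 1 ->
    (forall b, P b -> P (alpha * b)) ->
  forall b, b \in agenv <[alpha]>%VS -> P b.
Proof.
move=> P0 Plin P1 Pm b bA; have memP := mem_setspan_closed (S := P) P0 Plin.
apply: (memP b).1; move: b bA; apply/subvP; apply: agenv_sub_modl.
  by rewrite -memvE; apply: (memP 1).2.
apply/prodvP => c d /vlineP[k ->] /(memP d).1 Pd; apply: (memP _).2.
by rewrite -scalerAl -[_ *: _]addr0; apply: Plin => //; apply: Pm.
Qed.

(** By Leibniz, D(alpha b) = (D alpha) b + alpha (D b), and vanishing on W is a
    two-sided ideal. *)
Lemma nullon_Dgl_agenv W zeta p alpha b : homog p alpha ->
    nullon W (Dgl zeta alpha) -> b \in agenv <[alpha]>%VS ->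
  nullon W (Dgl zeta b).
Proof.
move=> ha hW; have [lD _ mD] := Dgl_derivation zeta; move: b.
apply: (@agenv_line_ind (fun b => nullon W (Dgl zeta b))) => [|k c d hc hd||c hc].
- by have := lD (-1) 0 0; rewrite scaler0 addr0 scaleN1r addNr => ->; apply: nullon0.
- by rewrite lD; apply: nullon_lin.
- rewrite /Dgl /ext_der big1 => [|i _]; first exact: nullon0.
  by rewrite contre_homog0 ?mulr0 //; apply: homog1.
rewrite (mD _ _ _ ha) mul0n scale1r.
by apply: nullonD; [apply: nullonMl|apply: nullonMr].
Qed.

Definition eval_Dgl b s (zeta : 'End(T)) : K^o := evs (Dgl zeta b) s.

Lemma eval_DglP b s : linear (eval_Dgl b s).
Proof.
move=> k z1 z2; have e := evs_feval _ (erefl (size s)).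
by rewrite /eval_Dgl !e; apply: linear_feval_Dgl.
Qed.
HB.instance Definition _ b s :=
  GRing.isLinear.Build K 'End(T) K^o _ (eval_Dgl b s) (eval_DglP b s).

(** With X a basis of W, the functionals attached to alpha and to the p-element
    subfamilies of X form a basis of the space spanned by [c_functionals]:
    stability lifts the dual forms of X to a dual family in gl(T), and a form of
    degree p that is zero on these subfamilies vanishes on W. *)
Lemma c_dim_stable (E W : {vspace T}) p alpha :
    homog p alpha -> stable E p alpha -> (W <= E)%VS ->
  c_dim (agenv <[alpha]>%VS) W = 'C(\dim W, p).
Proof.
move=> ha st WE; have p0 := stable_gt0 ha st.
pose X := vbasis W; have freeX : free X := basis_free (vbasisP W).
rewrite -{1}(card_ord (\dim W)) -card_draws.
set N := #|_|.
pose J (i : 'I_N) : {set 'I_(\dim W)} := enum_val i.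
have cardJ i : #|J i| = p by have := enum_valP i; rewrite inE => /eqP.
pose s i := subfamily X (J i).
have sz i : size (s i) = p by rewrite size_map -cardE.
have sW i : {subset s i <= W}.
  by move=> v /mapP[a _ ->]; apply/vbasis_mem/mem_nth; rewrite size_tuple.
pose f i : 'Hom('End(T), K^o) := linfun (eval_Dgl alpha (s i)).
have fE i zeta : f i zeta = evs (Dgl zeta alpha) (s i) by rewrite lfunE.
have [z hz] : exists z : 'I_N -> 'End(T),
    forall i, nullon E (Dgl (z i) alpha - dualform X (J i)).
  apply: (@fin_all_exists _ (fun=> 'End(T))
    (fun i zeta => nullon E (Dgl zeta alpha - dualform X (J i)))) => i.
  apply: (stable_lift ha st).
  by rewrite -[p in homog p _](cardJ i); apply: homog_prod.
apply: (@dim_setspan_dual _ _ _ f z).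
- move=> i; exists p, alpha, (fun a => nth 0 (s i) a); split => //.
  + by apply/(subvP (sub_agenv _))/memv_line.
  + by move=> a; apply/sW/mem_nth; rewrite sz.
  by move=> zeta; rewrite fE (evs_feval _ (sz i)).
- move=> i j; rewrite fE -[Dgl _ _](subrK (dualform X (J j))) -[_ - _]scale1r.
  rewrite evsP hz => [|v /sW]; last exact: (subvP WE).
  by rewrite mulr0 add0r evs_dualform ?cardJ // (inj_eq enum_val_inj).
move=> g [q [b [u [_ bA _ uW gE]]]] zeta f0; rewrite gE feval_evs.
apply: (nullon_Dgl_agenv ha _ bA) => [|_ /codomP[a ->] //].
rewrite -(span_basis (vbasisP W)); apply: nullon_span => t /subseq_subfamily[I ->].
have [eI|nI] := eqVneq #|I| p; last first.
  by apply: evs_homog (homog_Dgl zeta ha) _; rewrite size_map -cardE.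
have IN : I \in [set A : {set 'I_(\dim W)} | #|A| == p] by rewrite inE eI.
by have := f0 (enum_rank_in IN I); rewrite fE /s /J enum_rankK_in.
Qed.

(** * The image of eta |-> d_eta alpha *)

Lemma dim_rV : \dim {:T} = n.
Proof. by rewrite dimvf dim_matrix mul1r. Qed.

(** A vector x outside E completes a basis of E to one of T, and nu is the
    coordinate along x.  Choosing x freely rather than as a multiple of nu avoids
    any use of the positivity of the scalar product. *)
Lemma hyperplane_equation (E : {vspace T}) : (\dim E).+1 = n -> exists nu x : T,
  [/\ forall u, u \in E -> (nu *m u^T) 0 0 = 0, (nu *m x^T) 0 0 = 1
    & (E + <[x]>)%VS = fullv].
Proof.
move=> dE.
have /subvPn[x _ xE] : ~~ (fullv <= E)%VS.
  by apply/negP => /dimvS; rewrite dim_rV -[X in (X <= _)%N]dE ltnn.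
pose X := [tuple of x :: vbasis E].
have spanX : <<X>>%VS = (E + <[x]>)%VS.
  by rewrite span_cons (span_basis (vbasisP E)) addvC.
have freeX : free X.
  by rewrite free_cons (span_basis (vbasisP E)) xE (basis_free (vbasisP E)).
exists (dualcovec X ord0), x; split.
- move=> u /coord_vbasis ->; rewrite dualcovecE linear_sum big1 // => i _.
  by rewrite linearZ /= (coord_free (lift ord0 i) _ freeX) mulr0.
- by rewrite dualcovecE (coord_free ord0 _ freeX).
apply/eqP; rewrite eqEdim subvf dim_rV -spanX (eqP freeX).
by rewrite size_tuple dE leqnn.
Qed.

Lemma deta_linear b : linear (fun eta => deta eta b).
Proof.
move=> k y z; rewrite /deta /ext_der scaler_sumr -big_split; apply: eq_bigr => i _ /=.
rewrite scalerAl -mulrDl scalerN scaler_sumr -opprD -big_split; congr (- _ * _).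
apply: eq_bigr => j _ /=; rewrite scaler_sumr -big_split; apply: eq_bigr => l _ /=.
by rewrite !ffunE scalerDl scalerA.
Qed.

Definition deta_at b (eta : glT K n) := deta eta b.
HB.instance Definition _ b :=
  GRing.isLinear.Build K (glT K n) (ext K n) _ (deta_at b) (deta_linear b).

Lemma ZA0_ker p alpha : homog p alpha ->
  ZA0 (agenv <[alpha]>%VS) = lker (linfun (deta_at alpha)).
Proof.
move=> ha; apply/vspaceP => eta; rewrite memv_ker lfunE /=.
have [lD _ mD] := deta_derivation eta.
apply/idP/eqP => [/mem_ZA0|d0].
  by apply; apply/(subvP (sub_agenv _))/memv_line.
apply/mem_ZA0; apply: (@agenv_line_ind (fun b => deta eta b = 0)) => [|k b c hb hc||b hb].
- by have := lD (-1) 0 0; rewrite scaler0 addr0 scaleN1r addNr.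
- by rewrite lD hb hc scaler0 addr0.
- rewrite /deta /ext_der big1 // => i _.
  by rewrite contre_homog0 ?mulr0 //; apply: homog1.
by rewrite (mD _ _ _ ha) -[deta eta alpha]/(deta_at alpha eta) d0 hb mul0r mulr0 scaler0 addr0.
Qed.

(** The two minus signs, from the definition of [deta] and from
    e^k /\ e^j = - e^j /\ e^k, cancel. *)
Lemma deta_wedge u zeta : exists eta : glT K n,
  forall b, deta eta b = covec u * Dgl zeta b.
Proof.
exists [ffun t => u 0 t.1.2 * zeta (delta_mx 0 t.1.1) 0 t.2] => b.
rewrite /deta /Dgl /ext_der mulr_sumr; apply: eq_bigr => i _; rewrite mulrA.
congr (_ * _); rewrite /covec mulr_suml -sumrN; apply: eq_bigr => j _.
rewrite mulr_sumr -sumrN; apply: eq_bigr => l _; rewrite ffunE /=.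
rewrite (homogC (homog_gen K l) (homog_gen K j)) expr1 scaleN1r scalerN opprK.
by rewrite -scalerAl -scalerAr scalerA.
Qed.

(** Multiples of nu are reached first, because nu /\ b only depends on the
    restriction of b to E; for a general covector u, write b = v - nu /\ c with v
    in gl(T) . alpha and move nu to the front of u /\ nu /\ c. *)
Lemma wedge_in_limg_deta (E : {vspace T}) p alpha :
    homog p alpha -> (\dim E).+1 = n -> stable E p alpha ->
  forall u b, homog p b -> covec u * b \in limg (linfun (deta_at alpha)).
Proof.
move=> ha dE st; set L := limg _.
have LD u zeta : covec u * Dgl zeta alpha \in L.
  have [eta h] := deta_wedge u zeta.
  by apply/memv_imgP; exists eta; rewrite ?memvf // lfunE /= /deta_at h.
have [nu [x [nuE nux fullEx]]] := hyperplane_equation dE.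
(* [kill]: nu /\ b depends only on the restriction of b to E. *)
have kill b : nullon E b -> covec nu * b = 0 by apply: nullon_mul0 fullEx.
have Lnu b : homog p b -> covec nu * b \in L.
  move=> hb; have [zeta /kill] := stable_lift ha st hb.
  by rewrite mulrBr => /eqP; rewrite subr_eq0 => /eqP <-.
move=> u b hb; have [zeta hz] := stable_lift ha st hb.
pose g := Dgl zeta alpha - b; pose c := contr x g.
(* nu /\ g = 0, so contracting with x gives 0 = g - nu /\ c. *)
have eb : b = Dgl zeta alpha - covec nu * c.
  have := contr_covec_mul g nux; rewrite kill // linear0 => /esym/eqP.
  by rewrite subr_eq0 => /eqP <-; rewrite /g subKr.
have hc : homog p.-1 c.
  apply: homog_contr; rewrite /g -scaleN1r.
  by apply: homogD; [apply: homog_Dgl|apply: homogZ].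
rewrite eb mulrBr mulrA (homogC (homog_covec u) (homog_covec nu)) expr1.
rewrite scaleN1r mulNr opprK -mulrA; apply: rpredD => //; apply: Lnu.
rewrite -(prednK (stable_gt0 ha st)); apply: (@homogM _ _ 1 _) => //.
exact: homog_covec.
Qed.

Lemma dim_homog p :
  \dim <<[tuple ext_e K (enum_val i) | i < #|[set I : {set 'I_n} | #|I| == p]|]>>
    = 'C(n, p).
Proof.
rewrite -[in RHS](card_ord n) -card_draws.
set X := [tuple _ | i < _]; set N := #|_| in X *.
have XE (i : 'I_N) : X`_i = ext_e K (enum_val i) by rewrite -tnth_nth tnth_mktuple.
suff /eqP-> : free X by rewrite size_tuple.
apply/freeP => k k0 j; move/ffunP/(_ (enum_val j)): k0.
rewrite sum_ffunE (bigD1 j) //= big1 => [|i nij].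
  by rewrite XE !ffunE eqxx addr0 => <-; rewrite [RHS]mulr1.
by rewrite XE !ffunE (inj_eq enum_val_inj) eq_sym (negPf nij) scaler0.
Qed.

Lemma codim_ZA0 (E : {vspace T}) p alpha :
    homog p alpha -> (\dim E).+1 = n -> stable E p alpha ->
  (\dim {:glT K n} - \dim (ZA0 (agenv <[alpha]>%VS)) = 'C(n, p.+1))%N.
Proof.
move=> ha dE st; rewrite (ZA0_ker ha) -(limg_ker_dim (linfun (deta_at alpha))).
rewrite capfv addKn -dim_homog; set X := [tuple _ | i < _].
congr (\dim _); apply/eqP.
rewrite eqEsubv; apply/andP; split; apply/subvP => b.
  case/memv_imgP => eta _ ->; rewrite lfunE /= /deta_at.
  have [_ /(_ _ _ ha) /homogP hd _] := deta_derivation eta.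
  rewrite (ext_sum (deta eta alpha)); apply: rpred_sum => I _.
  have [eI|nI] := eqVneq #|I| p.+1; last by rewrite hd ?addn1 // scale0r rpred0.
  have IN : I \in [set J : {set 'I_n} | #|J| == p.+1] by rewrite inE eI.
  apply/rpredZ/memv_span; have := mem_tnth (enum_rank_in IN I) X.
  by rewrite tnth_mktuple enum_rankK_in.
move: b; apply/subvP/span_subvP => b /(tnthP X)[i ->]; rewrite tnth_mktuple.
set I := enum_val i; have /eqP eI : #|I| == p.+1 by have := enum_valP i; rewrite inE.
have [I0|[j jI]] := set_0Vmem I; first by rewrite I0 cards0 in eI.
have /(congr1 ( *:%R ((-1) ^+ ninv [set j] (I :\ j)))) := ext_eD1 jI.
rewrite scalerA -expr2 sqrr_sign scale1r => <-; apply: rpredZ.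
rewrite -covec_delta; apply: (wedge_in_limg_deta ha dE st).
by have := cardsD1 j I; rewrite eI jI => -[->]; apply: homog_e.
Qed.

(** * Ordinary flags *)

Lemma sum_bin n' p : (\sum_(i < n') 'C(i, p) = 'C(n', p.+1))%N.
Proof.
by elim: n' => [|m IH]; rewrite ?big_ord0 // big_ord_recr /= IH binS.
Qed.

Lemma ordinary_stable (E : {vspace T}) p alpha (W : nat -> {vspace T}) :
    homog p alpha -> (\dim E).+1 = n -> stable E p alpha ->
  flag W -> W n.-1 = E -> ordinary (agenv <[alpha]>%VS) W.
Proof.
move=> ha dE st [dW sW] WE; rewrite /ordinary (codim_ZA0 ha dE st) -sum_bin.
have sub k i : (i + k = n.-1)%N -> (W i <= E)%VS.
  elim: k i => [|k IH] i e; first by rewrite -WE -e addn0.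
  have iltn : (i < n)%N.
    by rewrite -dE ltnS -[\dim E]/(\dim E).+1.-1 dE -e leq_addr.
  have [WS _] := sW i iltn; apply: subv_trans WS _.
  by apply: IH; rewrite addSnnS.
apply: eq_bigr => i _; rewrite (c_dim_stable ha st) ?dW //; first exact: ltnW.
by apply: (sub (n.-1 - i)%N); rewrite subnKC // -ltnS (ltn_predK (ltn_ord i)).
Qed.
End Restriction.

Theorem proposition9 (R : realType) (n p : nat) (alpha : ext R n)
  (E : {vspace 'rV[R]_n}) :
  homog p alpha ->
  (\dim E).+1 = n ->
  stable E p alpha ->
  forall W : nat -> {vspace 'rV[R]_n},
    flag W -> W n.-1 = E -> ordinary (agenv <[alpha]>%VS) W.
Proof. by move=> ha dE st W fW WE; apply: ordinary_stable st fW WE. Qed.
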